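(* Let $M$ be a block monoid and let $a$ be an atom of $M$. Then $a$ is elementary if and only if $a$ is strong.
   Context: $\mathbb N$ denotes the nonnegative integers. Let $(G,+)$ be an abelian group and $G_0\subseteq G$. For a family $x=(x_g)_{g\in G_0}$ of elements of $\mathbb N$, its support is $\operatorname{supp}(x)=\{g\in G_0\mid x_g\ne0\}$. Such a family is a zero-sum sequence if its support is finite and $\sum_{g\in G_0}x_g g=0$ in $G$. The set $\mathcal B(G_0)$ of zero-sum sequences over $G_0$ is a monoid under componentwise addition, called the block monoid over $G_0$; a block monoid is a monoid $M=\mathcal B(G_0)$ for some such $G$ and $G_0$. A zero-sum sequence $x$ is elementary if its support is non-empty and minimal, that is, there is no zero-sum sequence $y$ with $\emptyset\ne\operatorname{supp}(y)\subsetneq\operatorname{supp}(x)$. For $a,b\in M$, $a\le_M b$ means $b=a+c$ for some $c\in M$. An atom is a nonzero element of $M$ that is not a sum of two nonzero elements of $M$. A strong atom is an element $x\in M\setminus\{0\}$ such that if $y\le_M kx$ for some $y\in M$ and $k\in\mathbb N$, then $y=lx$ for some $l\in\mathbb N$. *)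

(* Defs.v *)
From HB Require Import structures.
From mathcomp Require Import all_boot all_algebra.
From mathcomp Require Import all_classical.
Set Implicit Arguments.
Unset Strict Implicit.
Unset Printing Implicit Defensive.
Import GRing.Theory.
Local Open Scope classical_set_scope.
Local Open Scope ring_scope.

Definition supp (I : Type) (x : I -> nat) : set I := [set g | x g <> 0%N].

(* [G0 : set G] coerces to the type [{g : G | g \in G0}], so a family indexed
   by [G0] is a function [G0 -> nat]; such functions form an [nmodType] under
   pointwise addition. *)
Definition zero_sum (G : zmodType) (G0 : set G) : {pred (G0 -> nat)} :=
  fun x => `[< finite_set (supp x) /\
               \sum_(g \in supp x) \val g *+ x g = 0 >].

Lemma zero_sumP (G : zmodType) (G0 : set G) (x : G0 -> nat) :
  reflect (finite_set (supp x) /\ \sum_(g \in supp x) \val g *+ x g = 0)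
          (x \in @zero_sum G G0).
Proof. exact: asboolP. Qed.

Lemma supp_sum_widen (G : zmodType) (G0 : set G) (x : G0 -> nat) (A : set G0) :
  supp x `<=` A ->
  \sum_(g \in supp x) \val g *+ x g = \sum_(g \in A) \val g *+ x g.
Proof.
move=> sxA; apply: fsbig_widen => // g [_] /=.
by move=> /contrapT ->; rewrite mulr0n.
Qed.

Lemma zero_sum_addr_closed (G : zmodType) (G0 : set G) :
  addr_closed (@zero_sum G G0).
Proof.
have supp0 : supp (0 : G0 -> nat) = set0.
  by rewrite -subset0 => g /=; apply.
split=> [|x y /zero_sumP[fx sx] /zero_sumP[fy sy]]; apply/zero_sumP.
  by rewrite supp0 fsbig_set0; split => //; exact: finite_set0.
have fxy : finite_set (supp x `|` supp y) by rewrite finite_setU.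
have sub : supp (x + y) `<=` supp x `|` supp y.
  move=> g /= nz; apply: contrapT => /not_orP[/contrapT xg /contrapT yg].
  by apply: nz; rewrite -[LHS]/(x g + y g)%N xg yg.
split; first exact: sub_finite_set sub fxy.
rewrite (supp_sum_widen sub).
transitivity (\sum_(g \in supp x `|` supp y) (\val g *+ x g + \val g *+ y g)).
  by apply: eq_fsbigr => g _; rewrite -mulrnDr.
rewrite fsbig_split //=.
have <- := supp_sum_widen (@subsetUl _ (supp x) (supp y)).
have <- := supp_sum_widen (@subsetUr _ (supp x) (supp y)).
by rewrite sx sy addr0.
Qed.

Record block_monoid (G : zmodType) (G0 : set G) := BlockMonoid {
  block_val :> G0 -> nat;
  block_valP : block_val \in @zero_sum G G0
}.

HB.instance Definition _ (G : zmodType) (G0 : set G) :=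
  [isSub for @block_val G G0].
HB.instance Definition _ (G : zmodType) (G0 : set G) :=
  [Choice of block_monoid G0 by <:].
HB.instance Definition _ (G : zmodType) (G0 : set G) :=
  GRing.SubChoice_isSubNmodule.Build _ _ (block_monoid G0)
    (@zero_sum_addr_closed G G0).

Definition elementary (G : zmodType) (G0 : set G) (x : block_monoid G0) : Prop :=
  supp x !=set0 /\
  ~ exists y : block_monoid G0, supp y !=set0 /\ supp y `<` supp x.

Definition le_monoid (M : nmodType) (a b : M) : Prop := exists c : M, b = a + c.

Definition atom (M : nmodType) (a : M) : Prop :=
  a <> 0 /\ ~ exists b c : M, [/\ b <> 0, c <> 0 & a = b + c].

Definition strong_atom (M : nmodType) (x : M) : Prop :=
  x <> 0 /\
  forall (y : M) (k : nat), le_monoid y (x *+ k) -> exists l : nat, y = x *+ l.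

(* Main.v *)
Require Import Defs.
From mathcomp Require Import all_boot all_algebra.
From mathcomp Require Import all_classical.

(** Everything rests on the fact that divisibility in a block monoid is the
    componentwise order ([le_monoidP]): the difference of two zero-sum
    sequences, when its entries are nonnegative, is again zero-sum.

    Elementary atoms are strong.  Let [a] be elementary and [supp y] be
    contained in [supp a].  Among the [g] in [supp a], take one for which the
    ratio [y g / a g] is least.  Then [a g * y - y g * a] is a zero-sum sequence
    whose support lies in [supp a] and misses [g], so it vanishes: [y] is
    proportional to [a] ([elementary_proportional]).  Subtracting from [y] as
    many copies of [a] as possible leaves a proper divisor of [a], which is
    zero because [a] is an atom; hence [y] is a multiple of [a].

    Strong elements are elementary.  If [supp y] is contained in [supp a], the
    entries of [y], being bounded, are dominated by those of [a *+ k] for large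
    [k].  So [y] divides a multiple of [a], hence is itself a multiple of [a],
    and a nonzero multiple of [a] has the same support as [a]. *)

Set Implicit Arguments.
Unset Strict Implicit.
Unset Printing Implicit Defensive.
Import GRing.Theory.
Local Open Scope classical_set_scope.
Local Open Scope ring_scope.

(** The least ratio [y g / a g], written without division. *)
Lemma exists_min_ratio (T : eqType) (a y : T -> nat) (s : seq T) :
  s != [::] -> {in s, forall g, (0 < a g)%N} ->
  exists2 g, g \in s & {in s, forall h, (y g * a h <= y h * a g)%N}.
Proof.
elim: s => // h0 s IHs _ a_gt0.
have [-> | s_neq0] := eqVneq s [::].
  by exists h0; rewrite ?mem_head // => h; rewrite inE => /eqP ->.
have [|g gs g_min] := IHs s_neq0.
  by move=> h hs; apply: a_gt0; rewrite inE hs orbT.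
have [le_gh0 | /ltnW le_h0g] := leqP (y g * a h0) (y h0 * a g).
  exists g => [|h]; first by rewrite inE gs orbT.
  by rewrite inE => /orP[/eqP -> // | /g_min].
exists h0 => [|h]; first exact: mem_head.
rewrite inE => /orP[/eqP -> // | hs].
have ag_gt0 : (0 < a g)%N by apply: a_gt0; rewrite inE gs orbT.
rewrite -(leq_pmul2r ag_gt0) mulnAC.
apply: (@leq_trans (y g * a h0 * a h)); first by rewrite leq_mul2r le_h0g orbT.
by rewrite mulnAC [leqRHS]mulnAC leq_mul2r g_min ?orbT.
Qed.

Section BlockMonoid.
Variables (G : zmodType) (G0 : set G).
Implicit Types x y a : block_monoid G0.

Lemma block_valD x y g : (x + y) g = (x g + y g)%N.
Proof. by []. Qed.

Lemma block_val0 g : (0 : block_monoid G0) g = 0%N.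
Proof. by []. Qed.

Lemma block_valMn x k g : (x *+ k) g = (k * x g)%N.
Proof. by elim: k => [|k IHk]; rewrite ?mulr0n // mulrS block_valD IHk. Qed.

Lemma block_eqP x y : (forall g, x g = y g) -> x = y.
Proof. by move=> xy; apply: val_inj; apply/funext. Qed.

Lemma supp_eq0 x : ~ (supp x !=set0) -> x = 0.
Proof.
move=> suppx; apply: block_eqP => g; apply: contrapT => xg_neq0.
by apply: suppx; exists g.
Qed.

Lemma supp_finite x : finite_set (supp x).
Proof. by have /zero_sumP[] := block_valP x. Qed.

(** All supports lie in the finite set [supp y], over which the three sums can
    be compared termwise. *)
Lemma sub_zero_sum x y : (forall g, x g <= y g)%N ->
  (fun g => y g - x g)%N \in @zero_sum G G0.
Proof.
move=> le_xy; have /zero_sumP[finy sumy] := block_valP y.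
have /zero_sumP[_ sumx] := block_valP x.
have subx : supp x `<=` supp y.
  by move=> g xg yg; apply: xg; have := le_xy g; rewrite yg leqn0 => /eqP.
have subd : supp (fun g => y g - x g)%N `<=` supp y.
  by move=> g dg yg; apply: dg; rewrite yg.
apply/zero_sumP; split; first exact: sub_finite_set finy.
rewrite (supp_sum_widen subd).
rewrite -[LHS]add0r -{1}sumx (supp_sum_widen subx) -fsbig_split //= -{}[RHS]sumy.
by apply: eq_fsbigr => g _; rewrite -mulrnDr subnKC.
Qed.

Lemma le_monoidP x y : le_monoid x y <-> forall g, (x g <= y g)%N.
Proof.
split=> [[z ->] g | le_xy]; first by rewrite block_valD leq_addr.
exists (BlockMonoid (sub_zero_sum le_xy)).
by apply: block_eqP => g; rewrite block_valD /= subnKC.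
Qed.

(** A zero-sum sequence supported in an elementary [a] is proportional to [a]:
    the entry of [a g * y - y g * a] at [g] is zero, so minimality of [supp a]
    forces the whole difference to vanish. *)
Lemma elementary_proportional a y : elementary a -> supp y `<=` supp a ->
  exists2 g, supp a g & forall h, (y h * a g = y g * a h)%N.
Proof.
move=> [[g0 ag0] a_min] sub_ya; have /finite_seqP[s sE] := supp_finite a.
have memE g : supp a g = (g \in s) by rewrite sE.
have [|g gs|g gs g_min] := @exists_min_ratio _ a y s.
- by apply/eqP => s0; move: ag0; rewrite memE s0.
- by rewrite lt0n; apply/eqP; move: gs; rewrite -memE.
have ag : supp a g by rewrite memE.
exists g => //.
have /le_monoidP[z zE] : forall h, ((a *+ y g) h <= (y *+ a g) h)%N.
  move=> h; rewrite !block_valMn [(a g * _)%N]mulnC.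
  have [/g_min //|] := boolP (h \in s); move=> hs.
  suff -> : a h = 0%N by rewrite muln0.
  by apply: contrapT => ah; move/negP: hs; rewrite -memE; apply.
(* [z] is the difference [a g * y - y g * a]. *)
have zhE h : (a g * y h = y g * a h + z h)%N.
  by rewrite -!block_valMn -block_valD -zE.
suff z0 : z = 0 by move=> h; rewrite mulnC zhE z0 block_val0 addn0.
apply: supp_eq0 => suppz; apply: a_min; exists z; split => //; split.
  move=> h zh ah; apply: zh.
  have yh : y h = 0%N by apply: contrapT => /sub_ya.
  by have := zhE h; rewrite yh ah !muln0.
move=> sub_az; apply: (sub_az g ag); apply/eqP.
by rewrite -(eqn_add2l (y g * a g)) -zhE addn0 mulnC.
Qed.

(** With [y = (y g / a g) a], dividing [y g] by [a g] with remainder gives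
    [y = q a + y'] where [y'] is a proper divisor of [a]. *)
Lemma elementary_multiple a y : atom a -> elementary a ->
  supp y `<=` supp a -> exists l : nat, y = a *+ l.
Proof.
move=> [_ a_irr] a_elem /(elementary_proportional a_elem)[g ag prop].
have ag_gt0 : (0 < a g)%N by rewrite lt0n; apply/eqP.
exists (y g %/ a g)%N.
have /le_monoidP[y' yE] : forall h, ((a *+ (y g %/ a g)) h <= y h)%N.
  move=> h; rewrite block_valMn -(leq_pmul2r ag_gt0) prop mulnAC.
  by rewrite leq_mul2r leq_divM orbT.
have prop' h : (y' h * a g = y g %% a g * a h)%N.
  apply/eqP; rewrite -(eqn_add2l (y g %/ a g * a h * a g)) -mulnDl.
  have <- : y h = (y g %/ a g * a h + y' h)%N.
    by rewrite -block_valMn -block_valD -yE.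
  by rewrite prop [X in (X + _)%N]mulnAC -mulnDl -divn_eq.
have /le_monoidP[c aE] : forall h, (y' h <= a h)%N.
  move=> h; rewrite -(leq_pmul2r ag_gt0) prop' mulnC leq_mul2l.
  by rewrite ltnW ?ltn_mod ?orbT.
have c_neq0 : c <> 0.
  move=> c0; have /eqP := prop' g.
  have -> : y' g = a g by rewrite aE c0 addr0.
  by rewrite eqn_pmul2r // gtn_eqF // ltn_mod.
suff y'0 : y' = 0 by rewrite {1}yE y'0 addr0.
by apply: contrapT => y'_neq0; apply: a_irr; exists y', c.
Qed.

Lemma le_monoid_muln a y : supp y `<=` supp a ->
  exists k, le_monoid y (a *+ k).
Proof.
move=> sub_ya; have /finite_seqP[s sE] := supp_finite y.
(* The length of [y] bounds each of its entries. *)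
exists (\sum_(g <- s) y g)%N; apply/le_monoidP => g; rewrite block_valMn.
have [-> // | /eqP yg] := eqVneq (y g) 0%N.
have gs : g \in s by have : supp y g by []; rewrite sE.
have ag_gt0 : (0 < a g)%N by rewrite lt0n; apply/eqP; exact: sub_ya.
by rewrite (leq_trans _ (leq_pmulr _ ag_gt0)) // (big_rem g) //= leq_addr.
Qed.

Lemma supp_le_muln a y k : le_monoid y (a *+ k) -> supp y `<=` supp a.
Proof.
move=> /le_monoidP le_y g yg ag; apply: yg; have := le_y g.
by rewrite block_valMn ag muln0 leqn0 => /eqP.
Qed.

Lemma strong_elementary a : strong_atom a -> elementary a.
Proof.
move=> [a_neq0 a_strong]; split; first by apply: contrapT => /supp_eq0.
move=> [y [[g yg] [sub_ya nsub_ay]]].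
have [k /a_strong[l yE]] := le_monoid_muln sub_ya.
apply: nsub_ay => h ah yh; apply: yg; move/eqP: yh.
by rewrite yE !block_valMn muln_eq0 => /orP[/eqP -> // | /eqP].
Qed.

End BlockMonoid.

Theorem proposition19 (G : zmodType) (G0 : set G) (a : block_monoid G0) :
  atom a -> (elementary a <-> strong_atom a).
Proof.
move=> a_atom; split=> [a_elem | /strong_elementary //].
split=> [|y k /supp_le_muln]; first by case: a_atom.
exact: elementary_multiple.
Qed.
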